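(* Let $\mathcal P$ be a convex polygon in the Euclidean plane with area $K$ and sides $S_1,\dots,S_n$, let $O$ be an interior point of $\mathcal P$, and let $d_i$ be the perpendicular distance from $O$ to the line containing $S_i$. Let $\mu_O$ be the measure on $\partial\mathcal P$ with density $\frac{d_i}{2K}$ with respect to arclength on each side $S_i$. Then $\mu_O$ is normalized arclength measure on $\partial\mathcal P$ if and only if all the distances $d_1,\dots,d_n$ are equal. Equivalently, $\mu_O$ is normalized arclength measure if and only if $\mathcal P$ is tangential and its incircle is centered at $O$.
   Context: Normalized arclength measure on $\partial\mathcal P$ is the measure with constant density $1/L$ with respect to arclength, where $L$ is the perimeter of $\mathcal P$. A convex polygon is tangential if it has an incircle, i.e. a circle contained in it that is tangent to every side. *)

(* Defs.v *)
From HB Require Import structures.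
From mathcomp Require Import all_boot all_order all_algebra.
From mathcomp Require Import all_classical all_reals all_analysis.
From mathcomp Require Import measurable_realfun.

Set Implicit Arguments.
Unset Strict Implicit.
Unset Printing Implicit Defensive.
Import Order.TTheory GRing.Theory Num.Theory.
Import numFieldNormedType.Exports.
Local Open Scope classical_set_scope.
Local Open Scope ring_scope.

Section EuclideanPlane.
Variable R : realType.
Implicit Types (p q x c : R * R) (r t : R).

(* The library norm on R * R is the sup norm, so the Euclidean distance is
   introduced separately. *)
Definition edist p q : R :=
  Num.sqrt ((q.1 - p.1) ^+ 2 + (q.2 - p.2) ^+ 2).

Definition line_point p q t : R * R :=
  (line_path p.1 q.1 t, line_path p.2 q.2 t).

Definition line p q : set (R * R) := range (line_point p q).

Definition segment p q : set (R * R) := line_point p q @` `[0, 1].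

Definition line_dist x p q : R := inf [set edist x y | y in line p q].

(* Twice the signed area of the triangle p q x: its sign tells on which side of
   the directed line from p to q the point x lies. *)
Definition orient p q x : R :=
  (q.1 - p.1) * (x.2 - p.2) - (q.2 - p.2) * (x.1 - p.1).

Definition circle c r : set (R * R) := [set x | edist c x = r].

(* Tangency to the line (exactly one common point), at a point of the side. *)
Definition tangent_to_segment c r p q : Prop :=
  exists2 x, segment p q x & circle c r `&` line p q = [set x].

Lemma line_dist_ge0 x p q : 0 <= line_dist x p q.
Proof.
apply: lb_le_inf => [|_ [y _ <-]]; last exact: sqrtr_ge0.
by exists (edist x (line_point p q 0)), (line_point p q 0) => //; exists 0.
Qed.

End EuclideanPlane.

(* R * R with its Borel sigma-algebra. *)
Notation plane R := (measurableTypeR R * measurableTypeR R)%type.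

Definition area (R : realType) (P : set (R * R)) : R :=
  fine ((lebesgue_measure \x lebesgue_measure)%E (P : set (plane R))).

Section Arclength.
Context {R : realType} (p q : R * R).

(* Unit-speed parametrization of the segment from p to q by [0, edist p q];
   only meaningful when p != q. *)
Definition arclength_param (t : measurableTypeR R) : plane R :=
  line_point p q (t / edist p q).

Lemma measurable_arclength_param : measurable_fun setT arclength_param.
Proof.
have mt : measurable_fun [set: measurableTypeR R]
    (fun t : measurableTypeR R => t / edist p q : measurableTypeR R).
  by apply: measurable_funM => //; exact: measurable_cst.
have ml (a b : R) : measurable_fun [set: measurableTypeR R]
    (fun t : measurableTypeR R =>
       line_path a b (t / edist p q) : measurableTypeR R).
  rewrite /line_path; apply: measurable_funD; apply: measurable_funM => //.
  by apply: measurable_funB.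
by apply: measurable_fun_pair; exact: ml.
Qed.

Definition arclength : set (plane R) -> \bar R :=
  pushforward (mrestr lebesgue_measure (measurable_itv `[0, edist p q]))
    arclength_param.

Let measurable_preimage_param (A : set (plane R)) :
  measurable A -> measurable (arclength_param @^-1` A).
Proof.
by move=> mA; rewrite -[X in measurable X]setTI; exact: measurable_arclength_param.
Qed.

Let arclength0 : arclength set0 = 0%E.
Proof. by rewrite /arclength /pushforward preimage_set0 measure0. Qed.

Let arclength_ge0 A : (0 <= arclength A)%E.
Proof. by rewrite /arclength /pushforward; exact: measure_ge0. Qed.

Let arclength_sigma_additive : semi_sigma_additive arclength.
Proof.
move=> F mF tF mUF; rewrite /arclength /pushforward preimage_bigcup.
apply: measure_semi_sigma_additive => [i||].
- exact: measurable_preimage_param.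
- apply/trivIsetP => /= i j _ _ ij; rewrite -preimage_setI.
  by move/trivIsetP : tF => /(_ _ _ _ _ ij) ->//; rewrite preimage_set0.
- by rewrite -preimage_bigcup; exact: measurable_preimage_param.
Qed.

HB.instance Definition _ := isMeasure.Build _ _ _ arclength
  arclength0 arclength_ge0 arclength_sigma_additive.

End Arclength.

Section ConvexPolygon.
Context {R : realType} {n : nat}.
Variable v : 'I_n -> R * R.

(* The vertices are listed in cyclic order (clockwise or counterclockwise):
   every line through two consecutive vertices has all the other vertices
   strictly on one side. *)
Definition convex_polygon : Prop :=
  (2 < n)%N /\
  forall i j k : 'I_n, j != i -> j != ordS i -> k != i -> k != ordS i ->
    0 < orient (v i) (v (ordS i)) (v j) * orient (v i) (v (ordS i)) (v k).

(* The convex hull of the vertices. *)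
Definition polygon : set (R * R) :=
  [set x | exists w : 'I_n -> R,
    [/\ forall i, 0 <= w i, \sum_i w i = 1,
        x.1 = \sum_i w i * (v i).1 & x.2 = \sum_i w i * (v i).2]].

Definition side_length (i : 'I_n) : R := edist (v i) (v (ordS i)).

Definition perimeter : R := \sum_i side_length i.

Definition side_dist (x : R * R) (i : 'I_n) : R :=
  line_dist x (v i) (v (ordS i)).

Definition is_incircle (c : R * R) (r : R) : Prop :=
  [/\ 0 < r, circle c r `<=` polygon
    & forall i, tangent_to_segment c r (v i) (v (ordS i))].

Definition tangential : Prop := exists c r, is_incircle c r.

Section BoundaryMeasure.
Variable w : 'I_n -> {nonneg R}.

(* The measure on the boundary with constant density [w i] with respect to
   arclength on the i-th side, as a Borel measure on the plane. *)
Definition boundary_measure (A : set (plane R)) : \bar R :=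
  (\sum_(i < n) mscale (w i) (arclength (v i) (v (ordS i))) A)%E.

Let boundary_measure0 : boundary_measure set0 = 0%E.
Proof. by rewrite /boundary_measure big1. Qed.

Let boundary_measure_ge0 A : (0 <= boundary_measure A)%E.
Proof. by apply: sume_ge0 => i _; exact: measure_ge0. Qed.

Let boundary_measure_sigma_additive : semi_sigma_additive boundary_measure.
Proof.
move=> F mF tF mUF; rewrite [X in _ --> X](_ : _ =
    lim ((fun n => \sum_(0 <= i < n) boundary_measure (F i))%E @ \oo)).
  by apply: is_cvg_ereal_nneg_natsum => k _; exact: boundary_measure_ge0.
rewrite nneseries_sum//; apply: eq_bigr => /= i _.
exact: measure_semi_bigcup.
Qed.

HB.instance Definition _ := isMeasure.Build _ _ _ boundary_measure
  boundary_measure0 boundary_measure_ge0 boundary_measure_sigma_additive.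

End BoundaryMeasure.

Lemma mu_density_ge0 (O : R * R) (i : 'I_n) :
  0 <= side_dist O i / (2 * area polygon).
Proof.
apply: divr_ge0; first exact: line_dist_ge0.
by apply: mulr_ge0 => //; apply: fine_ge0; exact: measure_ge0.
Qed.

Lemma perimeterV_ge0 : 0 <= 1 / perimeter.
Proof. by rewrite divr_ge0// sumr_ge0// => i _; exact: sqrtr_ge0. Qed.

Definition mu (O : R * R) : {measure set (plane R) -> \bar R} :=
  boundary_measure (fun i => NngNum (mu_density_ge0 O i)).

Definition normalized_arclength : {measure set (plane R) -> \bar R} :=
  boundary_measure (fun=> NngNum perimeterV_ge0).

End ConvexPolygon.

(* Main.v *)
(* Comparing the two measures on the line through each side shows that they
   coincide if and only if d_i / (2K) = 1 / L for all i.  This makes all d_i equal;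
   conversely, if all d_i equal d, then 2K = sum_i d_i |S_i| = d L.  The area formula
   2K = sum_i d_i |S_i| is the shoelace formula: P, which is the intersection of the
   half-planes of its sides, is cut into triangles with apex v_0, and the area of a
   triangle comes from Fubini's theorem, its vertical slices having piecewise
   affine length.
   If all d_i equal d, the disc of radius d about O lies in every half-plane, hence
   in P; in particular the foot of the perpendicular from O to the line of S_i
   is in P, hence on S_i, which is tangency. *)
Require Import Defs.
From mathcomp Require Import all_boot all_order all_algebra.
From mathcomp Require Import all_classical all_reals all_analysis.
From mathcomp Require Import measurable_realfun ring lra zify.
Set Implicit Arguments.
Unset Strict Implicit.
Unset Printing Implicit Defensive.
Import Order.TTheory GRing.Theory Num.Theory.
Import numFieldNormedType.Exports.
Local Open Scope classical_set_scope.
Local Open Scope ring_scope.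

(* Not the extended distance of the library. *)
Local Notation edist := Defs.edist.

(* [s] is 1 for counterclockwise and -1 for clockwise vertices. *)
Definition triangle (R : realType) (s : R) (a b c : R * R) : set (R * R) :=
  [set x | [/\ 0 <= s * orient a b x, 0 <= s * orient b c x
             & 0 <= s * orient c a x]].

Definition ccw (R : realType) (n : nat) (s : R) (v : 'I_n -> R * R) : Prop :=
  forall i k : 'I_n, k != i -> k != ordS i ->
    0 < s * orient (v i) (v (ordS i)) (v k).

(** * Orientation and triangles *)

Section Orientation.
Context {R : realType}.
Implicit Types (o p q a b c d x : R * R) (s t : R).

Lemma orient_rot p q x : orient p q x = orient q x p.
Proof. by rewrite /orient; ring. Qed.

Lemma orient_swap p q x : orient p q x = - orient q p x.
Proof. by rewrite /orient; ring. Qed.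

Lemma orientpp p x : orient p p x = 0.
Proof. by rewrite /orient; ring. Qed.

Lemma orient_start p q : orient p q p = 0.
Proof. by rewrite /orient; ring. Qed.

Lemma orient_end p q : orient p q q = 0.
Proof. by rewrite /orient; ring. Qed.

(** The three-term Plücker relation between the cross products of the four vectors from [o] to [a],
    [b], [c], [d]. *)
Lemma orient_plucker o a b c d : orient o a c * orient o b d =
  orient o a b * orient o c d + orient o a d * orient o b c.
Proof. by rewrite /orient; ring. Qed.

Lemma orient_line_point p q a b t :
  orient p q (line_point a b t) = (1 - t) * orient p q a + t * orient p q b.
Proof. by rewrite /orient /line_point /line_path /=; ring. Qed.

(** [orient p q] is an affine function, so it commutes with combinations whose weights sum to 1. *)
Lemma orient_sum p q (I : finType) (v : I -> R * R) (w : I -> R) x :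
  \sum_i w i = 1 -> x.1 = \sum_i w i * (v i).1 ->
  x.2 = \sum_i w i * (v i).2 ->
  orient p q x = \sum_i w i * orient p q (v i).
Proof.
move=> w1 x1 x2.
(* The constant terms are multiplied by the total weight 1 so that everything merges into one
   sum. *)
transitivity ((q.1 - p.1) * (x.2 - p.2 * \sum_i w i)
  - (q.2 - p.2) * (x.1 - p.1 * \sum_i w i)).
  by rewrite w1 /orient !mulr1.
rewrite x1 x2 !mulr_sumr -!sumrB !mulr_sumr -sumrB.
by apply: eq_bigr => i _; rewrite /orient; ring.
Qed.

(** Each coordinate is the ratio of the signed area of the subtriangle opposite the vertex to that
    of [a b c]. *)
Lemma triangle_barycentric s a b c x :
  0 < s * orient a b c -> triangle s a b c x ->
  exists al be ga : R, [/\ [/\ 0 <= al, 0 <= be & 0 <= ga], al + be + ga = 1,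
    x.1 = al * a.1 + be * b.1 + ga * c.1 &
    x.2 = al * a.2 + be * b.2 + ga * c.2].
Proof.
move=> D0 [sab sbc sca].
have sumD : s * orient b c x + s * orient c a x + s * orient a b x
  = s * orient a b c by rewrite /orient; ring.
have D_neq0 : s * orient a b c != 0 by rewrite gt_eqF.
set D := s * orient a b c in D0 sumD D_neq0 *.
exists (s * orient b c x / D), (s * orient c a x / D), (s * orient a b x / D).
split.
- by split; rewrite divr_ge0// ltW.
- by rewrite -!mulrDl sumD divff.
- apply: (mulfI D_neq0); transitivity (s * orient b c x * a.1
    + s * orient c a x * b.1 + s * orient a b x * c.1).
    by rewrite /D /orient; ring.
  by field.
- apply: (mulfI D_neq0); transitivity (s * orient b c x * a.2
    + s * orient c a x * b.2 + s * orient a b x * c.2).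
    by rewrite /D /orient; ring.
  by field.
Qed.

(** An affine function that is nonnegative at the vertices is nonnegative at their convex
    combinations. *)
Lemma triangle_halfplane s p q a b c x :
  0 < s * orient a b c -> triangle s a b c x ->
  0 <= s * orient p q a -> 0 <= s * orient p q b -> 0 <= s * orient p q c ->
  0 <= s * orient p q x.
Proof.
move=> D0 /(triangle_barycentric D0) [al [be [ga]]].
move=> [[al0 be0 ga0] sum1 x1 x2] pa pb pc.
rewrite (_ : s * orient p q x = al * (s * orient p q a)
  + be * (s * orient p q b) + ga * (s * orient p q c)).
  by rewrite !addr_ge0// mulr_ge0.
have -> : ga = 1 - al - be by lra.
rewrite /orient x1 x2 (_ : ga = 1 - al - be); first by ring.
by lra.
Qed.

End Orientation.

(** * Fan triangulation *)

Section Fan.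
Context {R : realType} {m : nat} (s : R) (v : 'I_m.+3 -> R * R).
Hypothesis ccw_v : ccw s v.

(** Natural indices allow induction along the fan; [inord] sends every index from [m.+3] on to
    [ord0]. *)
Definition vertex (k : nat) : R * R := v (inord k).
Local Notation u := vertex.

Lemma ordS_inord k : (k < m.+2)%N -> ordS (inord k : 'I_m.+3) = inord k.+1.
Proof.
move=> km; apply: val_inj => /=.
by rewrite !inordK ?modn_small//; lia.
Qed.

Lemma ordS_inord_last : ordS (inord m.+2 : 'I_m.+3) = inord 0.
Proof. by apply: val_inj => /=; rewrite !inordK ?modnn//; lia. Qed.

Lemma inord_neq j k : (j < m.+3)%N -> (k < m.+3)%N -> j <> k ->
  (inord j : 'I_m.+3) != inord k.
Proof.
by move=> jm km jk; apply/eqP => /(congr1 val) /=; rewrite !inordK.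
Qed.

Lemma ccw_edge j k : (j < m.+2)%N -> (k < m.+3)%N -> k <> j -> k <> j.+1 ->
  0 < s * orient (u j) (u j.+1) (u k).
Proof.
move=> jm km kj kj1; rewrite /vertex -(ordS_inord jm)//.
by apply: ccw_v; [|rewrite ordS_inord//]; apply: inord_neq => //; lia.
Qed.

(** Seen from [u 0], the other vertices come in angular order. Convexity gives this for consecutive
    ones; induction on [k] gives the rest. *)
Lemma ccw_fan j k : (0 < j < k)%N -> (k < m.+3)%N ->
  0 < s * orient (u 0) (u j) (u k).
Proof.
elim: k => [|k IHk] /andP[j0 jk] km; first by [].
have [->|jneqk] := eqVneq j k.
  by rewrite orient_rot; apply: ccw_edge; lia.
have /IHk : (0 < j < k)%N by lia.
move=> /(_ (ltnW km)) cjk.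
have ckk : 0 < s * orient (u 0) (u k) (u k.+1).
  by rewrite orient_rot; apply: ccw_edge; lia.
have [->|jneq1] := eqVneq j 1; first by apply: ccw_edge; lia.
have c1j : 0 < s * orient (u 0) (u 1) (u j) by apply: ccw_edge; lia.
have c1k : 0 < s * orient (u 0) (u 1) (u k) by apply: ccw_edge; lia.
have c1k1 : 0 < s * orient (u 0) (u 1) (u k.+1) by apply: ccw_edge; lia.
(* After multiplication by the positive orientation of [u 0], [u 1], [u k], the Plücker relation for
   [u 1], [u j], [u k], [u k.+1] writes the goal as a sum of products of positive terms. *)
rewrite -(pmulr_rgt0 _ c1k).
by rewrite mulrACA orient_plucker mulrDr addr_gt0// -mulrACA mulr_gt0.
Qed.

Lemma ccw_weak i k : 0 <= s * orient (v i) (v (ordS i)) (v k).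
Proof.
have [->|ki] := eqVneq k i; first by rewrite orient_start mulr0.
have [->|kSi] := eqVneq k (ordS i); first by rewrite orient_end mulr0.
exact/ltW/ccw_v.
Qed.

Lemma polygon_halfplanes x : polygon v x ->
  forall i, 0 <= s * orient (v i) (v (ordS i)) x.
Proof.
move=> [w [w0 w1 x1 x2]] i; rewrite (orient_sum _ _ w1 x1 x2)// mulr_sumr.
by apply: sumr_ge0 => k _; rewrite mulrCA mulr_ge0// ccw_weak.
Qed.

(** Barycentric coordinates, extended by zero, are convex weights on all the vertices. Sums of
    indicators avoid a case analysis on coinciding indices. *)
Lemma triangle_polygon i j k : 0 < s * orient (v i) (v j) (v k) ->
  triangle s (v i) (v j) (v k) `<=` polygon v.
Proof.
move=> D0 x /(triangle_barycentric D0) [al [be [ga]]].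
move=> [[al0 be0 ga0] sum1 x1 x2].
have sumE (f : 'I_m.+3 -> R) :
    \sum_l (al *+ (l == i) + be *+ (l == j) + ga *+ (l == k)) * f l =
    al * f i + be * f j + ga * f k.
  have pick c (l0 : 'I_m.+3) : \sum_l (c *+ (l == l0)) * f l = c * f l0.
    rewrite (bigD1 l0)//= eqxx big1 ?addr0// => l /negbTE ->.
    by rewrite mulr0n mul0r.
  by under eq_bigr do rewrite !mulrDl; rewrite !big_split/= !pick.
exists (fun l => al *+ (l == i) + be *+ (l == j) + ga *+ (l == k)); split.
- by move=> l; rewrite !addr_ge0// mulrn_wge0.
- under eq_bigr do rewrite -[_ + _]mulr1.
  by rewrite (sumE (fun=> 1)) !mulr1.
- by rewrite sumE.
- by rewrite sumE.
Qed.

(** The diagonals from [u 0] cut the angle at [u 0] into sectors; the side opposite [u 0] closes the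
    sector of [x] to a triangle. *)
Lemma fan_cover x : (forall i, 0 <= s * orient (v i) (v (ordS i)) x) ->
  exists2 j, (j < m.+1)%N & triangle s (u 0) (u j.+1) (u j.+2) x.
Proof.
move=> xin.
have x1 : 0 <= s * orient (u 0) (u 1) x.
  by have := xin (inord 0); rewrite ordS_inord.
have xlast : 0 <= s * orient (u m.+2) (u 0) x.
  by have := xin (inord m.+2); rewrite ordS_inord_last.
have [j [jm [xj xj1]]] : exists j, (j < m.+1)%N /\
    0 <= s * orient (u 0) (u j.+1) x /\ 0 <= s * orient (u j.+2) (u 0) x.
  (* Search downwards from the last sector: if [x] is not on the inner side of the diagonal to
     [u k.+2], it lies before that diagonal. *)
  have sector k : (k <= m)%N -> 0 <= s * orient (u k.+2) (u 0) x ->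
      exists j, (j < m.+1)%N /\ 0 <= s * orient (u 0) (u j.+1) x /\
        0 <= s * orient (u j.+2) (u 0) x.
    elim: k => [|k IHk] km xk; first by exists 0%N.
    have [xk'|xk'] := leP 0 (s * orient (u 0) (u k.+2) x).
      by exists k.+1.
    apply: IHk; first exact: ltnW.
    by rewrite orient_swap mulrN oppr_ge0 ltW.
  exact: (sector m).
exists j => //; split => //.
by have := xin (inord j.+1); rewrite ordS_inord.
Qed.

Lemma fan_triangle_gt0 j : (j < m.+1)%N ->
  0 < s * orient (u 0) (u j.+1) (u j.+2).
Proof. by move=> jm; apply: ccw_fan; lia. Qed.

Lemma polygonE : polygon v = [set x | forall i,
  0 <= s * orient (v i) (v (ordS i)) x].
Proof.
apply/seteqP; split => [x|x xin]; first exact: polygon_halfplanes.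
have [j jm] := fan_cover xin; apply: triangle_polygon.
exact: fan_triangle_gt0.
Qed.

Lemma polygon_fan : polygon v =
  \big[setU/set0]_(j < m.+1) triangle s (u 0) (u j.+1) (u j.+2).
Proof.
rewrite -(bigcup_mkord _ (fun j => triangle s (u 0) (u j.+1) (u j.+2))).
apply/seteqP; split => [x xP|x [j/= jm]].
  by have [j jm xj] := fan_cover (polygon_halfplanes xP); exists j.
by apply: triangle_polygon; exact: fan_triangle_gt0.
Qed.

(** The diagonal from [u 0] to [u k.+1] separates the two triangles, so a common point lies on
    it. *)
Lemma fan_overlap j k x : (j < k < m.+1)%N ->
  triangle s (u 0) (u j.+1) (u j.+2) x ->
  triangle s (u 0) (u k.+1) (u k.+2) x -> s * orient (u 0) (u k.+1) x = 0.
Proof.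
move=> /andP[jk km] xj [xk _ _]; apply/eqP; rewrite eq_le xk andbT.
rewrite -oppr_ge0 -mulrN -orient_swap.
apply: triangle_halfplane xj _ _ _.
- by apply: fan_triangle_gt0; lia.
- by rewrite orient_end mulr0.
- by rewrite orient_rot; apply/ltW/ccw_fan; lia.
(* For adjacent triangles, [u j.+2] is itself the end of the diagonal. *)
- have [->|jk'] := eqVneq j.+2 k.+1; first by rewrite orient_start mulr0.
  by rewrite orient_rot; apply/ltW/ccw_fan; lia.
Qed.

End Fan.

(** * Areas *)

Section Area.
Context {R : realType}.
Local Notation leb := (@lebesgue_measure R).
Local Notation leb2 := (leb \x leb)%E.
Implicit Types (p q r h al be c k : R).

(** Ordinate at abscissa [x] of the line through [p] and [q]; meaningful for [p.1 != q.1]. *)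
Definition height (p q : R * R) (x : R) : R :=
  p.2 + (q.2 - p.2) / (q.1 - p.1) * (x - p.1).

Lemma orient_height (p q : R * R) x y : p.1 != q.1 ->
  orient p q (x, y) = (q.1 - p.1) * (y - height p q x).
Proof.
by move=> pq; rewrite /orient /height/=; field; rewrite subr_eq0 eq_sym.
Qed.

Lemma orient_above (p q : R * R) x y : p.1 < q.1 ->
  (0 <= orient p q (x, y)) = (height p q x <= y).
Proof.
move=> pq; rewrite orient_height ?lt_eqF//.
by rewrite pmulr_rge0 ?subr_gt0// subr_ge0.
Qed.

Lemma orient_below (p q : R * R) x y : q.1 < p.1 ->
  (0 <= orient p q (x, y)) = (y <= height p q x).
Proof.
move=> pq; rewrite orient_height ?gt_eqF//.
by rewrite nmulr_rge0 ?subr_lt0// subr_le0.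
Qed.

(** The left of a rightward edge lies above it and the left of a leftward edge lies below it, so the
    slice is a closed interval. *)
Lemma lebesgue_slice (p q p' q' : R * R) x l (A : set R) :
  p.1 < q.1 -> q'.1 < p'.1 -> 0 <= l ->
  l = height p' q' x - height p q x ->
  (forall y, A y <-> 0 <= orient p q (x, y) /\ 0 <= orient p' q' (x, y)) ->
  leb A = l%:E.
Proof.
move=> pq qp l0 lE AE.
have hh : height p q x <= height p' q' x by rewrite -subr_ge0 -lE.
rewrite (_ : A = `[height p q x, height p' q' x]%classic).
  rewrite lebesgue_measure_itv/= lte_fin lE; case: ltgtP hh => //.
  by move=> -> _; rewrite subrr.
apply/seteqP; split => y; rewrite /= in_itv/=.
  by move=> /AE; rewrite orient_above// orient_below// => -[-> ->].
by move=> /andP[? ?]; apply/AE; rewrite orient_above// orient_below.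
Qed.

Lemma continuous_affine k c : continuous (fun x : R => k * (x - c)).
Proof.
move=> x; apply: cvgM; first exact: cvg_cst.
by apply: cvgB; [exact: cvg_id|exact: cvg_cst].
Qed.

Lemma measurable_affine k c (D : set R) : measurable D ->
  measurable_fun D (fun x : R => (k * (x - c))%:E).
Proof.
move=> mD; apply/measurable_EFinP; apply: (measurable_funS measurableT) => //.
apply: continuous_measurable_fun; exact: continuous_affine.
Qed.

Lemma integral_affine c k p q : p < q ->
  (\int[leb]_(x in `]p, q[) (k * (x - c))%:E =
    (k * ((q - c) ^+ 2 - (p - c) ^+ 2) / 2)%:E)%E.
Proof.
move=> pq.
have dF (x : R) :
    is_derive x 1 (fun x : R => k * (x - c) ^+ 2 / 2) (k * (x - c)).
  apply: is_derive_eq.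
  by rewrite /GRing.scale/=; field.
have cF : continuous (fun x : R => k * (x - c) ^+ 2 / 2).
  move=> x; apply/differentiable_continuous/derivable1_diffP.
  exact: ex_derive.
(* The endpoints are added because the fundamental theorem is applied on a closed interval. *)
rewrite -(@integral_itv_bndoo _ p q _ true false); last first.
  exact: measurable_affine.
rewrite (@continuous_FTC2 _ _ (fun x : R => k * (x - c) ^+ 2 / 2))//.
- by rewrite -EFinB; congr EFin; field.
- exact/continuous_subspaceT/continuous_affine.
- split.
  + by move=> x _; exact: ex_derive.
  + by apply: cvg_at_right_filter; exact: cF.
  + by apply: cvg_at_left_filter; exact: cF.
- by move=> x _; rewrite derive1E; exact: derive_val.
Qed.

(* When [q = p] or [q = r] the quotient by zero only concerns an empty range. *)
Lemma area_tent (A : set (plane R)) p q r h : measurable A ->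
  p <= q -> q <= r -> p < r -> 0 <= h ->
  (forall x, x < p \/ r < x -> xsection A x = set0) ->
  (forall x, p < x < q -> leb (xsection A x) = (h / (q - p) * (x - p))%:E) ->
  (forall x, q < x < r -> leb (xsection A x) = (- (h / (r - q)) * (x - r))%:E) ->
  leb2 A = (h * (r - p) / 2)%:E.
Proof.
move=> mA pq qr pr h0 Aout Al Ar.
pose f1 x := (h / (q - p) * (x - p))%:E.
pose f2 x := (- (h / (r - q)) * (x - r))%:E.
have f1_ge0 x : (0 <= (f1 \_ `]p, q[) x)%E.
  rewrite patchE; case: ifPn => //; rewrite inE/= in_itv/= => /andP[px xq].
  by rewrite lee_fin mulr_ge0 ?divr_ge0 ?subr_ge0 ?(ltW px).
have f2_ge0 x : (0 <= (f2 \_ `]q, r[) x)%E.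
  rewrite patchE; case: ifPn => //; rewrite inE/= in_itv/= => /andP[qx xr].
  by rewrite lee_fin mulNr -mulrN opprB mulr_ge0 ?divr_ge0 ?subr_ge0 ?(ltW xr).
have mf1 : measurable_fun setT (f1 \_ `]p, q[).
  by apply/(measurable_restrictT _ (measurable_itv _)); apply: measurable_affine.
have mf2 : measurable_fun setT (f2 \_ `]q, r[).
  by apply/(measurable_restrictT _ (measurable_itv _)); apply: measurable_affine.
transitivity (\int[leb]_x ((f1 \_ `]p, q[) x + (f2 \_ `]q, r[) x))%E.
  apply: ge0_ae_eq_integral => //.
  - exact: measurable_fun_xsection.
  - exact: emeasurable_funD.
  - by move=> x _; rewrite adde_ge0.
  (* The slice lengths are prescribed away from the three break points, which form a null set. *)
  exists [set` [:: p; q; r]]; split.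
  - by apply: countable_measurable => //; exact/finite_set_countable/finite_seq.
  - by apply: countable_lebesgue_measure0; exact/finite_set_countable/finite_seq.
  apply: subsetCl => x /= /negP; rewrite !inE !negb_or => /and3P[xp xq xr] _.
  rewrite !patchE !mem_setE !in_itv/=.
  move: xp xq xr; rewrite !neq_lt => xp xq xr.
  have [/andP[px qx]|npq] := boolP (p < x < q).
    by rewrite ltNge (ltW qx)/= adde0 Al// px.
  have [/andP[px qx]|nqr] := boolP (q < x < r).
    by rewrite add0e Ar// px.
  rewrite adde0 Aout ?measure0//.
  by lra.
rewrite ge0_integralD// -!integral_mkcond.
rewrite (_ : \int[leb]_(x in `]p, q[) f1 x = (h * (q - p) / 2)%:E)%E; last first.
  move: pq; rewrite le_eqVlt => /predU1P[->|pq].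
    by rewrite set_itvE integral_set0 subrr mulr0 mul0r.
  rewrite integral_affine//; congr EFin; field.
  by rewrite subr_eq0 gt_eqF.
rewrite (_ : \int[leb]_(x in `]q, r[) f2 x = (h * (r - q) / 2)%:E)%E; last first.
  move: qr; rewrite le_eqVlt => /predU1P[->|qr].
    by rewrite set_itvE integral_set0 subrr mulr0 mul0r.
  rewrite integral_affine//; congr EFin; field.
  by rewrite subr_eq0 gt_eqF.
by rewrite -EFinD; congr EFin; field.
Qed.

Lemma measurable_orient (a b : R * R) :
  measurable_fun setT (orient a b : plane R -> measurableTypeR R).
Proof.
have mB (c : R) (f : plane R -> measurableTypeR R) :
    measurable_fun setT f -> measurable_fun setT (fun x => f x - c).
  by move=> mf; exact: measurable_funB.
apply: measurable_funB; apply: measurable_funM => //.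
  by apply: measurable_funB => //; exact: measurable_cst.
- by apply: mB; exact: measurable_fst.
Qed.

Lemma measurable_halfplane (s : R) (a b : R * R) :
  measurable ([set x | 0 <= s * orient a b x] : set (plane R)).
Proof.
rewrite -[X in measurable X]setTI.
apply: (measurable_fun_le (f := fun=> 0) (g := fun x => s * orient a b x)) => //.
by apply: measurable_funM => //; exact: measurable_orient.
Qed.

Lemma measurable_triangle (s : R) (a b c : R * R) :
  measurable (triangle s a b c : set (plane R)).
Proof.
rewrite (_ : triangle s a b c = [set x | 0 <= s * orient a b x] `&`
    [set x | 0 <= s * orient b c x] `&` [set x | 0 <= s * orient c a x]).
  by apply: measurableI; [apply: measurableI|]; exact: measurable_halfplane.
by apply/seteqP; split => x [] => [|[]].
Qed.

Lemma triangle_rot (s : R) (a b c : R * R) : triangle s a b c = triangle s b c a.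
Proof. by apply/seteqP; split => x []. Qed.

(** The slice length is a tent: zero at the extreme abscissas, with its peak over the middle vertex.
    The peak is twice the area divided by the width. *)
Lemma area_triangle_leftmost (a b c : R * R) :
  0 < orient a b c -> a.1 <= b.1 -> a.1 <= c.1 ->
  leb2 (triangle 1 a b c) = (orient a b c / 2)%:E.
Proof.
move=> D0 ab ac.
have in_section x y : xsection (triangle 1 a b c) x y <->
    [/\ 0 <= orient a b (x, y), 0 <= orient b c (x, y)
      & 0 <= orient c a (x, y)].
  by rewrite /xsection/= inE /triangle/= !mul1r.
(* [sumD] and [barx] are the barycentric identities, for total mass and abscissa. They decide which
   slices are empty and which edge conditions are implied. *)
have sumD x y : orient b c (x, y) + orient c a (x, y) + orient a b (x, y)
    = orient a b c by rewrite /orient/=; ring.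
have barx x y : orient b c (x, y) * (x - a.1) + orient c a (x, y) * (x - b.1)
    + orient a b (x, y) * (x - c.1) = 0 by rewrite /orient/=; ring.
have [bc|cb] := leP b.1 c.1.
- have ac' : a.1 < c.1.
    rewrite lt_neqAle ac andbT; apply/eqP => E; move: D0.
    have bE : b.1 = a.1 by lra.
    by rewrite /orient bE -E !subrr mul0r mulr0 subrr ltxx.
  have caN0 : c.1 - a.1 != 0 by rewrite subr_eq0 gt_eqF.
  have h0 : 0 <= orient a b c / (c.1 - a.1).
    by apply: divr_ge0; [exact: ltW|rewrite subr_ge0 ltW].
  rewrite (@area_tent _ a.1 b.1 c.1 (orient a b c / (c.1 - a.1)))//.
  + by rewrite divfK.
  + exact: measurable_triangle.
  + move=> x xout; apply/seteqP; split => // y /in_section[s1 s2 s3].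
    (* All vertices lie strictly on one side of the abscissa [x], so [barx] makes the three
       coordinates vanish, against [sumD]. *)
    have sumDx := sumD x y; have barxy := barx x y.
    case: xout => xout; nra.
  + move=> x /andP[ax xb].
    have ab' := lt_trans ax xb.
    apply: (@lebesgue_slice a b c a x) => //.
    * by apply: mulr_ge0; [apply: divr_ge0 => //|]; rewrite subr_ge0 ltW.
    * rewrite /height /orient; field; rewrite caN0 !subr_eq0.
      by rewrite !(gt_eqF ab') (lt_eqF ac').
    (* In [barx], [x] lies to the right of [a] and to the left of [b] and [c]; this yields the
       condition for the edge [b c]. *)
    * move=> y; rewrite in_section; split => [[]//|[s1 s3]]; split => //.
      have sumDx := sumD x y; have barxy := barx x y.
      nra.
  + move=> x /andP[bx xc].
    have bc' := lt_trans bx xc.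
    apply: (@lebesgue_slice b c c a x) => //.
    * rewrite mulNr -mulrN opprB.
      by apply: mulr_ge0; [apply: divr_ge0 => //|]; rewrite subr_ge0 ltW.
    * rewrite /height /orient; field; rewrite caN0 !subr_eq0.
      by rewrite !(gt_eqF bc') (lt_eqF ac').
    * move=> y; rewrite in_section; split => [[]//|[s2 s3]]; split => //.
      have sumDx := sumD x y; have barxy := barx x y.
      nra.
(* Now [c] is the middle vertex: [a b] bounds every slice from below, while the upper edge changes
   from [c a] to [b c]. *)
- have ab' : a.1 < b.1 by exact: le_lt_trans cb.
  have baN0 : b.1 - a.1 != 0 by rewrite subr_eq0 gt_eqF.
  have h0 : 0 <= orient a b c / (b.1 - a.1).
    by apply: divr_ge0; [exact: ltW|rewrite subr_ge0 ltW].
  rewrite (@area_tent _ a.1 c.1 b.1 (orient a b c / (b.1 - a.1)))//.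
  + by rewrite divfK.
  + exact: measurable_triangle.
  + exact: ltW.
  + move=> x xout; apply/seteqP; split => // y /in_section[s1 s2 s3].
    have sumDx := sumD x y; have barxy := barx x y.
    case: xout => xout; nra.
  + move=> x /andP[ax xc].
    have ac' := lt_trans ax xc.
    apply: (@lebesgue_slice a b c a x) => //.
    * by apply: mulr_ge0; [apply: divr_ge0 => //|]; rewrite subr_ge0 ltW.
    * rewrite /height /orient; field; rewrite baN0 !subr_eq0.
      by rewrite !(gt_eqF ac') (lt_eqF ac').
    * move=> y; rewrite in_section; split => [[]//|[s1 s3]]; split => //.
      have sumDx := sumD x y; have barxy := barx x y.
      nra.
  + move=> x /andP[cx xb].
    apply: (@lebesgue_slice a b b c x) => //.
    * rewrite mulNr -mulrN opprB.
      by apply: mulr_ge0; [apply: divr_ge0 => //|]; rewrite subr_ge0 ltW.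
    * rewrite /height /orient; field; rewrite baN0 !subr_eq0.
      by rewrite !(gt_eqF cb) (lt_eqF cb).
    * move=> y; rewrite in_section; split => [[]//|[s1 s2]]; split => //.
      have sumDx := sumD x y; have barxy := barx x y.
      nra.
Qed.

(** A cyclic rotation puts a leftmost vertex first. *)
Lemma area_triangle_ccw (a b c : R * R) : 0 < orient a b c ->
  leb2 (triangle 1 a b c) = (orient a b c / 2)%:E.
Proof.
move=> D0.
have [ab|ba] := leP a.1 b.1; have [ac|ca] := leP a.1 c.1.
- exact: area_triangle_leftmost.
- rewrite -triangle_rot -orient_rot area_triangle_leftmost//.
  + by rewrite orient_rot.
  + exact: ltW.
  + exact: le_trans (ltW ca) ab.
- rewrite triangle_rot orient_rot area_triangle_leftmost//.
  + by rewrite -orient_rot.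
  + exact: le_trans (ltW ba) ac.
  + exact: ltW.
- have [bc|cb] := leP b.1 c.1.
    rewrite triangle_rot orient_rot area_triangle_leftmost//.
    + by rewrite -orient_rot.
    + exact: ltW.
  rewrite -triangle_rot -orient_rot area_triangle_leftmost//.
  + by rewrite orient_rot.
  + exact: ltW.
  + exact: ltW.
Qed.

Lemma area_triangle (s : R) (a b c : R * R) : s = 1 \/ s = -1 ->
  0 < s * orient a b c ->
  leb2 (triangle s a b c) = (s * orient a b c / 2)%:E.
Proof.
case=> ->; first by rewrite mul1r; exact: area_triangle_ccw.
have swapE (p q x : R * R) : -1 * orient p q x = orient q p x.
  by rewrite mulN1r -orient_swap.
(* Exchanging two vertices makes a clockwise triangle counterclockwise. *)
rewrite (_ : triangle (-1) a b c = triangle 1 a c b).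
  by rewrite swapE orient_rot; exact: area_triangle_ccw.
by apply/seteqP; split => x []; rewrite /triangle/= !swapE !mul1r.
Qed.

Lemma measurable_line (a b : R * R) :
  measurable ([set x | orient a b x = 0] : set (plane R)).
Proof.
rewrite (_ : [set x | _] = orient a b @^-1` [set 0])//.
rewrite -[X in measurable X]setTI.
exact: (measurable_orient a b) measurableT _ (measurable_set1 0).
Qed.

(** A vertical line is a product with a null factor; any other line has one-point vertical slices,
    and Fubini applies. *)
Lemma area_line (a b : R * R) : a != b ->
  leb2 [set x | orient a b x = 0] = 0%E.
Proof.
move=> ab; have [ab1|ab1] := eqVneq a.1 b.1.
  have ab2 : b.2 - a.2 != 0.
    rewrite subr_eq0; apply: contra_neq ab => ba2.
    by rewrite (surjective_pairing a) (surjective_pairing b) ab1 ba2.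
  rewrite (_ : [set x | _] = [set a.1] `*` setT).
    by rewrite product_measure1E// [X in (X * _)%E]lebesgue_measure_set1 mul0e.
  apply/seteqP; split => [[x y]|[x y] [/= -> _]] /=.
    rewrite /orient/= -ab1 subrr mul0r sub0r => /eqP.
    by rewrite oppr_eq0 mulf_eq0 (negbTE ab2) subr_eq0 => /eqP xa; split.
  by rewrite /orient/= -ab1 !subrr; ring.
apply: integral0_eq => x _ /=.
apply: (@subset_measure0 _ _ _ leb _ [set height a b x]) => //.
- by apply: measurable_xsection; exact: measurable_line.
- move=> y; rewrite /xsection/= inE/= orient_height// => /eqP.
  rewrite mulf_eq0 subr_eq0 eq_sym (negbTE ab1)/= subr_eq0.
  by move=> /eqP.
- exact: lebesgue_measure_set1.
Qed.

End Area.

(** * Area of a convex polygon *)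

(** Changing the base point alters the sum by a linear expression in the total of the side vectors,
    which is zero around a closed polygon. *)
Lemma sum_orient (R : realType) n (v : 'I_n -> R * R) (x y : R * R) :
  \sum_i orient (v i) (v (ordS i)) x = \sum_i orient (v i) (v (ordS i)) y.
Proof.
have sumS (f : 'I_n -> R) : \sum_i (f (ordS i) - f i) = 0.
  by rewrite sumrB [X in _ - X](reindex_inj (@ordS_inj n)) subrr.
apply/eqP; rewrite -subr_eq0 -sumrB.
rewrite (eq_bigr (fun i =>
    (x.2 - y.2) * ((v (ordS i)).1 - (v i).1)
    - (x.1 - y.1) * ((v (ordS i)).2 - (v i).2))); last first.
  by move=> i _; rewrite /orient; ring.
rewrite sumrB -!mulr_sumr (sumS (fun i => (v i).1)) (sumS (fun i => (v i).2)).
by rewrite !mulr0 subrr.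
Qed.

Section PolygonArea.
Context {R : realType} {m : nat} (s : R) (v : 'I_m.+3 -> R * R).
Hypothesis s_sign : s = 1 \/ s = -1.
Hypothesis ccw_v : ccw s v.
Local Notation u := (vertex v).
Local Notation leb2 := (@lebesgue_measure R \x @lebesgue_measure R)%E.

Lemma ccw_neq j k : (0 < j < k)%N -> (k < m.+3)%N -> u 0 != u j.
Proof.
move=> jk km; apply/eqP => u0j.
by have := ccw_fan ccw_v jk km; rewrite u0j orientpp mulr0 ltxx.
Qed.

Lemma area_fan k : (k <= m.+1)%N ->
  leb2 (\big[setU/set0]_(j < k) triangle s (u 0) (u j.+1) (u j.+2)) =
  (\sum_(j < k) s * orient (u 0) (u j.+1) (u j.+2) / 2)%:E.
Proof.
have mT j : measurable (triangle s (u 0) (u j.+1) (u j.+2) : set (plane R)).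
  exact: measurable_triangle.
have mU n : measurable (\big[setU/set0]_(j < n)
    triangle s (u 0) (u j.+1) (u j.+2) : set (plane R)).
  by apply: bigsetU_measurable => j _; exact: mT.
elim: k => [|k IHk] km; first by rewrite !big_ord0 measure0.
(* Inclusion-exclusion: the new triangle meets the earlier ones only on its first diagonal, a null
   set. *)
rewrite !big_ord_recr/= measureUfinl//=; [|exact: mU|by rewrite IHk ?ltry// ltnW].
rewrite IHk ?(ltnW km)// area_triangle//; last exact: fan_triangle_gt0.
rewrite [X in (_ - X)%E](_ : _ = 0%E) ?sube0 ?EFinD//.
case: k km {IHk} => [|k] km.
  by rewrite big_ord0 set0I measure0.
apply: (@subset_measure0 _ _ _ leb2 _ [set x | orient (u 0) (u k.+2) x = 0]).
- by apply: measurableI => //; exact: mU.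
- exact: measurable_line.
- rewrite -(bigcup_mkord _ (fun j => triangle s (u 0) (u j.+1) (u j.+2))).
  move=> x [[j/= jk] xj xk].
  have : s * orient (u 0) (u k.+2) x = 0.
    by apply: (fan_overlap ccw_v _ xj xk); lia.
  by case: s_sign => ->; lra.
- by apply/area_line/(@ccw_neq _ k.+3); lia.
Qed.

(* Shoelace formula *)
Lemma measure_polygon (x : R * R) :
  leb2 (polygon v) = (s * (\sum_i orient (v i) (v (ordS i)) x) / 2)%:E.
Proof.
rewrite (polygon_fan ccw_v) area_fan//; congr EFin.
rewrite -mulr_suml -mulr_sumr; congr (_ * _ / _).
(* Based at [u 0], the first and last sides contribute zero, since they contain [u 0]; the other
   terms are the fan triangles. *)
rewrite (sum_orient v x (u 0)) [RHS]big_ord_recl [X in _ = _ + X]big_ord_recr/=.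
rewrite [X in _ = X + _](_ : _ = 0) ?add0r; last first.
  rewrite /vertex (_ : inord 0 = ord0) ?orient_start//.
  by apply: val_inj; rewrite /= inordK.
rewrite [X in _ = _ + X](_ : _ = 0) ?addr0; last first.
  rewrite (_ : ordS (lift _ _) = inord 0) ?orient_end//.
  by apply: val_inj => /=; rewrite inordK// modnn.
apply: eq_bigr => j _.
rewrite orient_rot; congr (orient (v _) (v _) _).
  by apply: val_inj => /=; rewrite inordK// /bump/=; case: j => j /=; lia.
apply: val_inj => /=; rewrite /bump/= inordK ?modn_small//.
all: by case: j => j /=; lia.
Qed.

End PolygonArea.

(** * Distances and tangency *)

Section Distance.
Context {R : realType}.
Implicit Types (p q x y c : R * R) (r t : R).

Lemma edist_ge0 p q : 0 <= edist p q.
Proof. exact: sqrtr_ge0. Qed.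

Lemma sqr_edist p q : edist p q ^+ 2 = (q.1 - p.1) ^+ 2 + (q.2 - p.2) ^+ 2.
Proof. by rewrite sqr_sqrtr// addr_ge0 ?sqr_ge0. Qed.

Lemma edist_gt0 p q : p != q -> 0 < edist p q.
Proof.
move=> pq; rewrite sqrtr_gt0 lt_neqAle addr_ge0 ?sqr_ge0// andbT eq_sym.
apply: contra_neq pq => /eqP; rewrite paddr_eq0 ?sqr_ge0// !sqrf_eq0 !subr_eq0.
by move=> /andP[/eqP ? /eqP ?]; 
  rewrite (surjective_pairing p) (surjective_pairing q); congr pair.
Qed.

(** Parameter of the orthogonal projection of [x] on the line: a dot product over a squared
    length. *)
Definition foot_param x p q : R :=
  ((x.1 - p.1) * (q.1 - p.1) + (x.2 - p.2) * (q.2 - p.2)) / edist p q ^+ 2.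

Definition foot x p q : R * R := line_point p q (foot_param x p q).

(** Pythagoras at the foot, multiplied by the squared length of [p q]. *)
Lemma sqr_edist_line_point x p q t : p != q ->
  (edist x (line_point p q t) * edist p q) ^+ 2 =
  orient p q x ^+ 2 + ((t - foot_param x p q) * edist p q ^+ 2) ^+ 2.
Proof.
move=> pq; have l0 : edist p q ^+ 2 != 0 by rewrite sqrf_eq0 gt_eqF ?edist_gt0.
rewrite mulrBl divfK// exprMn !sqr_edist /orient /line_point /line_path/=.
ring.
Qed.

Lemma edist_foot x p q : p != q ->
  edist x (foot x p q) * edist p q = `|orient p q x|.
Proof.
move=> pq; apply/eqP; rewrite -(@eqrXn2 _ 2) ?normr_ge0 ?mulr_ge0 ?edist_ge0//.
by rewrite sqr_edist_line_point// subrr mul0r expr0n addr0 real_normK ?num_real.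
Qed.

Lemma edist_foot_le x p q t : p != q ->
  edist x (foot x p q) <= edist x (line_point p q t).
Proof.
move=> pq; rewrite -(ler_pM2r (edist_gt0 pq)).
rewrite -(@ler_pXn2r _ 2) ?nnegrE ?mulr_ge0 ?edist_ge0//.
rewrite !sqr_edist_line_point// subrr mul0r expr0n addr0 lerDl.
exact: sqr_ge0.
Qed.

Lemma edist_line_point_inj x p q t : p != q ->
  edist x (line_point p q t) = edist x (foot x p q) -> t = foot_param x p q.
Proof.
move=> pq tE; have := sqr_edist_line_point x t pq.
have /eqP l0 : edist p q ^+ 2 != 0 by rewrite sqrf_eq0 gt_eqF ?edist_gt0.
rewrite tE edist_foot// real_normK ?num_real// => /eqP.
rewrite addrC -subr_eq subrr eq_sym sqrf_eq0 mulf_eq0 subr_eq0.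
by move=> /orP[/eqP|/eqP].
Qed.

Lemma line_dist_foot x p q : p != q -> line_dist x p q = edist x (foot x p q).
Proof.
move=> pq; apply/eqP; rewrite eq_le; apply/andP; split.
  apply: ge_inf.
    by exists 0 => _ [y _ <-]; exact: edist_ge0.
  by exists (foot x p q) => //; exists (foot_param x p q).
apply: lb_le_inf.
  by exists (edist x (foot x p q)), (foot x p q) => //; exists (foot_param x p q).
by move=> _ [_ [t tT <-] <-]; exact: edist_foot_le.
Qed.

Lemma line_distM x p q : p != q -> line_dist x p q * edist p q = `|orient p q x|.
Proof. by move=> pq; rewrite line_dist_foot// edist_foot. Qed.

Lemma circle_line_foot x p q : p != q ->
  circle x (line_dist x p q) `&` line p q = [set foot x p q].
Proof.
move=> pq; rewrite line_dist_foot//; apply/seteqP; split.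
  by move=> y [+ [t _ ty]]; rewrite -ty => /(edist_line_point_inj pq) ->.
by move=> _ ->; split => //; exists (foot_param x p q).
Qed.

(* The reflection of a common point across the foot is again a common point. *)
Lemma circle_line_dist c r p q x : p != q ->
  circle c r `&` line p q = [set x] -> line_dist c p q = r.
Proof.
move=> pq rx; have : (circle c r `&` line p q) x by rewrite rx.
move=> [/= cx [t _ tx]].
set t0 := foot_param c p q.
have cx' : edist c (line_point p q (t0 *+ 2 - t)) = r.
  rewrite -cx -tx; apply: (mulIf (lt0r_neq0 (edist_gt0 pq))); apply/eqP.
  rewrite -(@eqrXn2 _ 2) ?mulr_ge0 ?edist_ge0// !sqr_edist_line_point// -/t0.
  by apply/eqP; ring.
have : (circle c r `&` line p q) (line_point p q (t0 *+ 2 - t)).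
  by split => //; exists (t0 *+ 2 - t).
rewrite rx -tx => /= tE.
(* The point equals its reflection, and some coordinate of [q - p] is nonzero, so the parameters
   agree. *)
suff tt0 : t = t0 by rewrite line_dist_foot// -cx -tx tt0.
move: tE => [] /eqP; rewrite -subr_eq0 => t1 /eqP; rewrite -subr_eq0 => t2.
have {}t1 : (t0 - t) * (q.1 - p.1) = 0.
  by move/eqP: t1; rewrite /line_path => t1; lra.
have {}t2 : (t0 - t) * (q.2 - p.2) = 0.
  by move/eqP: t2; rewrite /line_path => t2; lra.
have [/eqP|tt0] := eqVneq (t0 - t) 0; first by rewrite subr_eq0 => /eqP.
case/eqP: pq; rewrite (surjective_pairing p) (surjective_pairing q).
by congr pair; apply/esym/eqP; rewrite -subr_eq0; apply/eqP/(mulfI tt0);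
  rewrite mulr0.
Qed.

(** Cauchy-Schwarz for the cross product of [q - p] and [y - x]; by Lagrange's identity the defect
    of the squares is the squared dot product. *)
Lemma orient_edist p q x y :
  `|orient p q y - orient p q x| <= edist p q * edist x y.
Proof.
rewrite -(@ler_pXn2r _ 2) ?nnegrE ?mulr_ge0 ?edist_ge0//.
rewrite real_normK ?num_real// exprMn !sqr_edist -subr_ge0.
set e := _ - _.
suff -> : e = ((q.1 - p.1) * (y.1 - x.1) + (q.2 - p.2) * (y.2 - x.2)) ^+ 2.
  exact: sqr_ge0.
by rewrite /e /orient; ring.
Qed.

End Distance.

(** * Arclength on the sides *)

Section SideMeasure.
Context {R : realType}.
Local Notation leb := (@lebesgue_measure R).
Implicit Types (p q a b : R * R).

Lemma arclength_line p q : p != q ->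
  arclength p q [set x | orient p q x = 0] = (edist p q)%:E.
Proof.
move=> pq; rewrite /arclength /pushforward /mrestr.
rewrite (_ : _ `&` _ = `[0, edist p q]%classic).
  by rewrite lebesgue_measure_itv/= lte_fin edist_gt0// sube0.
rewrite setIC; apply/setIidPl => t _.
by rewrite /preimage/= /arclength_param orient_line_point orient_start
  orient_end !mulr0 addr0.
Qed.

(* The side meets a line that does not contain it in at most one point. *)
Lemma arclength_other_line p q a b : p != q ->
  (orient a b p != 0) || (orient a b q != 0) ->
  arclength p q [set x | orient a b x = 0] = 0%E.
Proof.
move=> pq ab0; rewrite /arclength /pushforward /mrestr.
set al := orient a b p in ab0 *; set be := orient a b q in ab0 *.
(* The value [al / (al - be)] is the zero of the affine function going from [al] to [be] on
   [[0, 1]], rescaled to arclength. *)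
apply: (@subset_measure0 _ _ _ leb _ [set edist p q * (al / (al - be))]).
- apply: measurableI => //; rewrite -[X in measurable X]setTI.
  apply: measurable_arclength_param => //; exact: measurable_line.
- exact: measurable_set1.
- move=> t [/=]; rewrite /arclength_param orient_line_point -/al -/be.
  set u := _ / _ => tE _; have l0 := lt0r_neq0 (edist_gt0 pq).
  have albe : al - be != 0.
    apply: contraTneq ab0 => /eqP; rewrite subr_eq0 => /eqP albe.
    have al0 : al = 0 by move: tE; rewrite -albe -mulrDl subrK mul1r.
    by rewrite -albe al0 eqxx.
  have uE : u = al / (al - be).
    by apply: (mulIf albe); rewrite divfK//; lra.
  by rewrite -uE mulrC divfK.
- exact: lebesgue_measure_set1.
Qed.

End SideMeasure.

(** * Cyclic indices and the orientation of a convex polygon *)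

Lemma val_ordS n (i : 'I_n) :
  val (ordS i) = (if i.+1 == n then 0 else i.+1)%N.
Proof.
case: i => i /= ilt; have [->|ni] := eqVneq; first by rewrite modnn.
by rewrite modn_small//; lia.
Qed.

Lemma ordS_neq n (i : 'I_n) : (1 < n)%N -> ordS i != i.
Proof.
move=> n1; apply/eqP => /(congr1 val); rewrite val_ordS.
by case: i => i /= ilt; case: eqP; lia.
Qed.

Lemma ordSS_neq n (i : 'I_n) : (2 < n)%N -> ordS (ordS i) != i.
Proof.
move=> n2; apply/eqP => /(congr1 val); rewrite !val_ordS.
by case: i => i /= ilt; case: (i.+1 =P n); case: eqP; lia.
Qed.

(** From [i], climb to the last index, wrap around to 0, then climb to [j]. *)
Lemma ordS_connected n (P : 'I_n -> Prop) (i j : 'I_n) :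
  (forall k, P k -> P (ordS k)) -> P i -> P j.
Proof.
move=> PS Pi.
have [n' nE] : exists n', n = n'.+1.
  by case: n i {j P PS Pi} => [[]//|n' _]; exists n'.
subst n.
have P0 : P ord0.
  have up d : (i + d < n'.+1)%N -> P (inord (i + d)).
    elim: d => [|d IHd] id; first by rewrite addn0 inord_val.
    have /IHd/PS : (i + d < n'.+1)%N by lia.
    congr P; apply: val_inj; rewrite val_ordS /= !inordK//; last by lia.
    by case: eqP; lia.
  have := up (n' - i)%N; rewrite subnKC; last by case: i {Pi up} => i /=; lia.
  move=> /(_ (ltnSn _))/PS; congr P; apply: val_inj; rewrite val_ordS /= inordK//.
  by rewrite eqxx.
rewrite -(inord_val j); elim: (val j) (ltn_ord j) => [|k IHk] kn.
  by move: P0; congr P; apply: val_inj; rewrite /= inordK.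
have /IHk/PS : (k < n'.+1)%N by lia.
by congr P; apply: val_inj; rewrite val_ordS /= !inordK//; [case: eqP; lia|lia].
Qed.

(** Convexity fixes a sign for each side separately; the signs of consecutive sides agree, hence all
    do. *)
Lemma convex_polygon_ccw (R : realType) n (v : 'I_n -> R * R) :
  convex_polygon v -> exists2 s : R, s = 1 \/ s = -1 & ccw s v.
Proof.
move=> [n2 vP]; pose turn i := orient (v i) (v (ordS i)) (v (ordS (ordS i))).
have n1 : (1 < n)%N by lia.
have iSS (i : 'I_n) : ordS (ordS i) != i /\ ordS (ordS i) != ordS i.
  by split; [exact: ordSS_neq|exact: ordS_neq].
have turn_side i k : k != i -> k != ordS i ->
    0 < turn i * orient (v i) (v (ordS i)) (v k).
  by have [? ?] := iSS i; exact: vP.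
(* Read cyclically, the turn at side [i] is the orientation of side [ordS i] against the vertex
   [v i]. *)
have turnS i : 0 < turn i * turn (ordS i).
  rewrite mulrC {2}/turn orient_rot.
  apply: turn_side.
    by rewrite eq_sym ordS_neq.
  by rewrite eq_sym ordSS_neq.
have i0 : 'I_n by exists 0%N; lia.
have t0 : turn i0 != 0.
  by apply: contraTneq (turnS i0) => ->; rewrite mul0r ltxx.
have turn_same i : 0 < turn i0 * turn i.
  apply: (@ordS_connected _ (fun i => 0 < turn i0 * turn i) i0).
    by move=> j t0j; have := turnS j; nra.
  by rewrite -expr2 exprn_even_gt0.
case/lt_total/orP: t0 => t0; [exists (-1)|exists 1]; [by right| |by left|];
  by move=> i k ki kSi; have := turn_same i; have := turn_side i k ki kSi; nra.
Qed.

(** * Boundary measures and incircles of an oriented polygon *)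

Section Polygon.
Context {R : realType} {m : nat} (s : R) (v : 'I_m.+3 -> R * R).
Hypothesis s_sign : s = 1 \/ s = -1.
Hypothesis ccw_v : ccw s v.
Implicit Types (i j : 'I_m.+3) (O x : R * R).

Lemma side_neq i : v i != v (ordS i).
Proof.
apply/eqP => vS; have := ccw_v (ordSS_neq i isT) (ordS_neq (ordS i) isT).
by rewrite -vS orientpp mulr0 ltxx.
Qed.

Lemma side_length_gt0 i : 0 < side_length v i.
Proof. exact/edist_gt0/side_neq. Qed.

Lemma perimeter_gt0 : 0 < perimeter v.
Proof.
rewrite /perimeter (bigD1 ord0)//= ltr_pwDl ?side_length_gt0//.
by apply: sumr_ge0 => i _; exact/ltW/side_length_gt0.
Qed.

Lemma normr_sign : `|s| = 1.
Proof. by case: s_sign => ->; rewrite ?normrN normr1. Qed.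

Lemma side_distM O i : polygon v O ->
  side_dist v O i * side_length v i = s * orient (v i) (v (ordS i)) O.
Proof.
move=> OP; rewrite line_distM ?side_neq//.
rewrite -[RHS]ger0_norm ?(polygon_halfplanes ccw_v)//.
by rewrite normrM normr_sign mul1r.
Qed.

(** The shoelace sum based at [O]: each term is base times height of the triangle over a side with
    apex [O]. *)
Lemma area_polygon O : polygon v O ->
  2 * area (polygon v) = \sum_i side_dist v O i * side_length v i.
Proof.
move=> OP; rewrite /area (measure_polygon s_sign ccw_v O)/=.
rewrite mulrC divfK// mulr_sumr.
by apply: eq_bigr => i _; rewrite side_distM.
Qed.

Lemma area_polygon_gt0 : 0 < area (polygon v).
Proof.
rewrite /area (polygon_fan ccw_v) area_fan//= big_ord_recl ltr_pwDl//.
  by rewrite divr_gt0//; exact: fan_triangle_gt0.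
apply: sumr_ge0 => j _; rewrite divr_ge0//; exact/ltW/fan_triangle_gt0.
Qed.

Lemma arclength_side i j :
  arclength (v j) (v (ordS j))
    [set x | orient (v i) (v (ordS i)) x = 0] =
  (if j == i then side_length v i else 0)%:E.
Proof.
have [->|ji] := eqVneq j i; first exact/arclength_line/side_neq.
have nonzero k : k != i -> k != ordS i ->
    orient (v i) (v (ordS i)) (v k) != 0.
  move=> ki kSi; have := ccw_v ki kSi.
  by apply: contraTneq => ->; rewrite mulr0 ltxx.
apply: arclength_other_line; first exact: side_neq.
(* At least one endpoint of side [j] is off the line of side [i]: its start if side [i] follows it,
   otherwise its end. *)
have [Sji|Sji] := eqVneq (ordS j) i.
  rewrite nonzero//; apply: contra_neq (ordSS_neq i isT) => <-.
  exact: Sji.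
by rewrite [X in _ || X]nonzero ?orbT// (inj_eq (@ordS_inj _)).
Qed.

(** The line of a side is a test set isolating the density there, since the other sides meet it in
    arclength zero. *)
Lemma boundary_measure_side (w : 'I_m.+3 -> {nonneg R}) i :
  boundary_measure v w [set x | orient (v i) (v (ordS i)) x = 0] =
  ((w i)%:num * side_length v i)%:E.
Proof.
rewrite /boundary_measure (bigD1 i)//= big1 ?adde0.
  by rewrite /mscale/= [X in (_ * X)%E]arclength_side eqxx EFinM.
move=> j /negbTE ji.
by rewrite /mscale/= [X in (_ * X)%E]arclength_side ji mule0.
Qed.

Lemma boundary_measure_eq (w1 w2 : 'I_m.+3 -> {nonneg R}) :
  (forall A : set (plane R), measurable A ->
     boundary_measure v w1 A = boundary_measure v w2 A) <->
  (forall i, (w1 i)%:num = (w2 i)%:num).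
Proof.
split=> [w12 i|w12 A _].
  have := w12 _ (measurable_line (v i) (v (ordS i))).
  rewrite !boundary_measure_side => -[].
  exact/mulIf/lt0r_neq0/side_length_gt0.
by apply: eq_bigr => i _; rewrite /mscale/= w12.
Qed.

Lemma mu_eq_arclength O : polygon v O ->
  (forall A : set (plane R), measurable A ->
     mu v O A = normalized_arclength v A) <->
  (forall i j, side_dist v O i = side_dist v O j).
Proof.
move=> OP; apply: (iff_trans (boundary_measure_eq _ _)) => /=.
have L0 := perimeter_gt0; have K0 := area_polygon_gt0.
split=> [dL i j|d_eq i].
  have K2 : (2 * area (polygon v))^-1 != 0.
    by rewrite invr_neq0// mulf_neq0// gt_eqF.
  by apply: (mulIf K2); rewrite !dL.
have -> : 2 * area (polygon v) = side_dist v O i * perimeter v.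
  rewrite (area_polygon OP) mulr_sumr; apply: eq_bigr => j _.
  by rewrite (d_eq j i).
(* A zero common distance would make the area zero. *)
have d0 : side_dist v O i != 0.
  apply/eqP => d0; have := area_polygon OP.
  rewrite big1 => [|j _]; last by rewrite (d_eq j i) d0 mul0r.
  by apply/eqP; rewrite mulf_neq0// gt_eqF.
by rewrite invfM mulrA divff.
Qed.

(** On the line of a side, the half-plane of the previous side forces the parameter to be at least
    0, that of the next side at most 1. *)
Lemma line_polygon_segment i x : line (v i) (v (ordS i)) x -> polygon v x ->
  segment (v i) (v (ordS i)) x.
Proof.
move=> [t _ <-] xP; exists t => //=; rewrite in_itv/=.
have xin := polygon_halfplanes ccw_v xP.
apply/andP; split.
  have := xin (ord_pred i).
  have [h ->] : exists h, i = ordS h by exists (ord_pred i); rewrite ord_predK.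
  rewrite ordSK orient_line_point orient_end mulr0 add0r mulrCA.
  by rewrite pmulr_lge0// ccw_v ?ordSS_neq// ordS_neq.
have := xin (ordS i).
rewrite orient_line_point orient_start mulr0 addr0 mulrCA.
rewrite pmulr_lge0 ?subr_ge0//; apply: ccw_v; first by rewrite eq_sym ordS_neq.
by rewrite eq_sym ordSS_neq.
Qed.

(** Moving a distance [r] from [O] changes the orientation by at most the side length times [r],
    which is its signed value at [O]. *)
Lemma circle_polygon O r : polygon v O -> (forall i, side_dist v O i = r) ->
  circle O r `<=` polygon v.
Proof.
move=> OP dr x /= Ox; rewrite (polygonE ccw_v) => i.
have : `|s * (orient (v i) (v (ordS i)) x - orient (v i) (v (ordS i)) O)|
    <= side_length v i * r.
  by rewrite normrM normr_sign mul1r -Ox orient_edist.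
rewrite ler_norml mulrBr -(side_distM i OP) dr => /andP[+ _].
by rewrite mulrC; lra.
Qed.

Lemma is_incircleP O r : polygon v O ->
  is_incircle v O r <-> 0 < r /\ forall i, side_dist v O i = r.
Proof.
move=> OP; split=> [[r0 _ tan]|[r0 dr]].
  split=> // i; have [x _] := tan i.
  exact/circle_line_dist/side_neq.
split=> //; first exact: circle_polygon.
move=> i; have [vi ri] := (side_neq i, dr i).
have footE := circle_line_foot O vi.
rewrite -/(side_dist v O i) ri in footE.
exists (foot O (v i) (v (ordS i))) => //.
have [cf lf] : (circle O r `&` line (v i) (v (ordS i)))
    (foot O (v i) (v (ordS i))).
  by rewrite footE.
exact/line_polygon_segment/(circle_polygon OP dr).
Qed.

End Polygon.

Theorem corollary2p2 (R : realType) (n : nat) (v : 'I_n -> R * R) (O : R * R) :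
  convex_polygon v -> interior (polygon v) O ->
  ((forall A : set (plane R), measurable A -> mu v O A = normalized_arclength v A)
    <-> (forall i j : 'I_n, side_dist v O i = side_dist v O j))
  /\
  ((forall A : set (plane R), measurable A -> mu v O A = normalized_arclength v A)
    <-> (tangential v /\ exists r : R, is_incircle v O r)).
Proof.
move=> vP /interior_subset OP.
have [s s_sign ccw_v] := convex_polygon_ccw vP.
(* Convexity includes [2 < n], so [n] has the form [m.+3]. *)
case: n v vP OP ccw_v => [|[|[|m]]] v [// _ _] OP ccw_v.
have muE := mu_eq_arclength s_sign ccw_v OP.
split=> //; apply: (iff_trans muE); split=> [d_eq|[_ [r]]]; last first.
  by move=> /(is_incircleP s_sign ccw_v _ OP)[_ dr] i j; rewrite !dr.
suff Or : is_incircle v O (side_dist v O ord0).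
  by split; [exists O|]; exists (side_dist v O ord0).
apply/(is_incircleP s_sign ccw_v _ OP); split=> [|i]; last exact: d_eq.
(* The radius is positive, since a zero common distance would give area zero. *)
rewrite lt_neqAle line_dist_ge0 andbT eq_sym; apply/eqP => d0.
have := area_polygon s_sign ccw_v OP.
rewrite big1 => [|j _]; last by rewrite (d_eq j ord0) d0 mul0r.
by apply/eqP; rewrite mulf_neq0// gt_eqF// (area_polygon_gt0 s_sign ccw_v).
Qed.
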